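(* Let $L\subset\mathbb{Z}^m$ be a non-zero lattice with $L\cap\mathbb{N}^m=\{\mathbf 0\}$. Suppose that $I_L$ has a binomial generating set $\{B_1,\ldots,B_t\}$ such that every $B_i$ is a difference of two squarefree monomials. If $I_L$ has a unique minimal system of binomial generators, then $\mathrm{bar}(I_L)=\mu(I_L)$.
   Context: $K$ is a field, $I_L=(\mathbf x^{\mathbf u_+}-\mathbf x^{\mathbf u_-}:\mathbf u\in L)\subset K[x_1,\ldots,x_m]$, where $\mathbf u_\pm$ are the positive/negative parts of $\mathbf u$ and $\mathbf x^{\mathbf v}=x_1^{v_1}\cdots x_m^{v_m}$. $\mu(I_L)$ is the common cardinality of minimal binomial generating sets of $I_L$. $\mathrm{bar}(I_L)$ is the least $s$ such that there exist binomials $B_1,\ldots,B_s\in I_L$ with $\mathrm{rad}(I_L)=\mathrm{rad}(B_1,\ldots,B_s)$. *)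

(* Defs.v *)
From HB Require Import structures.
From mathcomp Require Import all_boot all_order all_algebra.
From mathcomp Require Import mpoly.
Set Implicit Arguments. Unset Strict Implicit. Unset Printing Implicit Defensive.
Import Order.TTheory GRing.Theory Num.Theory.
Local Open Scope ring_scope.

Section LatticeIdeals.
Variables (m : nat) (K : fieldType).

Definition is_lattice (L : {pred 'rV[int]_m}) : Prop :=
  0 \in L /\ (forall u v, u \in L -> v \in L -> u - v \in L).

Definition posp (u : 'rV[int]_m) : 'X_{1..m} :=
  [multinom `|Num.max (u ord0 i) 0|%N | i < m].
Definition negp (u : 'rV[int]_m) : 'X_{1..m} :=
  [multinom `|Num.max (- u ord0 i) 0|%N | i < m].

Definition lbinom (u : 'rV[int]_m) : {mpoly K[m]} := 'X_[posp u] - 'X_[negp u].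

Definition ideal_gen (S : {mpoly K[m]} -> Prop) (f : {mpoly K[m]}) : Prop :=
  exists n (c g : 'I_n -> {mpoly K[m]}),
    (forall i, S (g i)) /\ f = \sum_(i < n) c i * g i.

Definition lattice_ideal (L : {pred 'rV[int]_m}) : {mpoly K[m]} -> Prop :=
  ideal_gen (fun f => exists2 u, u \in L & f = lbinom u).

Definition radical (I : {mpoly K[m]} -> Prop) (f : {mpoly K[m]}) : Prop :=
  exists k : nat, I (f ^+ k).

Definition is_binomial (f : {mpoly K[m]}) : Prop :=
  exists a b : 'X_{1..m}, f = 'X_[a] - 'X_[b].

Definition squarefree_mon (a : 'X_{1..m}) : Prop := forall i, (a i <= 1)%N.

Definition is_sqfree_binomial (f : {mpoly K[m]}) : Prop :=
  exists a b : 'X_{1..m}, [/\ squarefree_mon a, squarefree_mon b &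
                             f = 'X_[a] - 'X_[b]].

Definition gen_seq (G : seq {mpoly K[m]}) := ideal_gen (fun f => f \in G).

Definition same_ideal (I J : {mpoly K[m]} -> Prop) : Prop := forall f, I f <-> J f.

Definition minimal_binomial_gens (I : {mpoly K[m]} -> Prop)
    (G : seq {mpoly K[m]}) : Prop :=
  [/\ uniq G, (forall g, g \in G -> is_binomial g), same_ideal (gen_seq G) I &
      forall H : seq {mpoly K[m]}, {subset H <= G} -> ~ {subset G <= H} ->
        ~ same_ideal (gen_seq H) I].

(* uniqueness of the minimal system of binomial generators (up to the sign
   of each binomial, the only possible ambiguity for pure binomials) *)
Definition unique_minimal_binomial_gens (I : {mpoly K[m]} -> Prop) : Prop :=
  forall G G', minimal_binomial_gens I G -> minimal_binomial_gens I G' ->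
    forall g, g \in G -> (g \in G') || (- g \in G').

Definition rad_by_binomials (I : {mpoly K[m]} -> Prop) (B : seq {mpoly K[m]}) :=
  (forall g, g \in B -> is_binomial g /\ I g) /\
  same_ideal (radical I) (radical (gen_seq B)).

Definition bar_is (I : {mpoly K[m]} -> Prop) (n : nat) : Prop :=
  (exists2 B, size B = n & rad_by_binomials I B) /\
  (forall B, rad_by_binomials I B -> (n <= size B)%N).

End LatticeIdeals.

(* Main.v *)
Require Import Defs.
From HB Require Import structures.
From mathcomp Require Import all_boot all_order all_algebra.
From mathcomp Require Import mpoly.
Import Order.TTheory GRing.Theory Num.Theory.
Local Open Scope ring_scope.

(** Uniqueness of the minimal system [G] forces the monomials occurring in [G]
    to form an antichain for divisibility: if a monomial of [g'] divides a
    monomial of [g], rewriting that monomial of [g] by means of [g'] yields a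
    generating system containing neither [g] nor [-g].  Moreover these monomials
    are squarefree, hence determined by their supports.  Let [B] be binomials
    with the same radical as [I_L], and let [x^a] be a monomial of [g] in [G].
    At the indicator vector of [supp a] the binomial [g] takes the value [1] or
    [-1], so some element of [B] does not vanish there, and hence contains a
    monomial [x^c] with [supp c] inside [supp a].  As [x^c] occurs in an element
    of [I_L], it is divisible by a monomial of [G], which by squarefreeness
    divides [x^a] and so equals it; thus [supp c = supp a].
    The [2 * size G] supports of the monomials of [G] therefore all occur among
    the at most [2 * size B] supports of the monomials of [B]. *)

(** * Closure properties of generated ideals *)

Section IdealGeneration.
Local Set Implicit Arguments.
Local Unset Strict Implicit.
Context {m : nat} {K : fieldType}.
Implicit Types (S T : {mpoly K[m]} -> Prop) (f g : {mpoly K[m]}).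

Lemma ideal_gen0 S : ideal_gen S 0.
Proof.
by exists 0%N, (fun=> 0), (fun=> 0); split=> [[]//|]; rewrite big_ord0.
Qed.

Lemma ideal_gen_mem S f : S f -> ideal_gen S f.
Proof.
by move=> Sf; exists 1%N, (fun=> 1), (fun=> f); split=> //; rewrite big_ord1 mul1r.
Qed.

Lemma ideal_genM S c f : ideal_gen S f -> ideal_gen S (c * f).
Proof.
move=> [n [d [g [Sg ->]]]]; exists n, (fun i => c * d i), g; split=> //.
by rewrite mulr_sumr; apply: eq_bigr => i _; rewrite mulrA.
Qed.

Lemma ideal_genD S f g : ideal_gen S f -> ideal_gen S g -> ideal_gen S (f + g).
Proof.
move=> [n1 [c1 [g1 [S1 ->]]]] [n2 [c2 [g2 [S2 ->]]]].
pose glue (u1 : 'I_n1 -> {mpoly K[m]}) u2 (i : 'I_(n1 + n2)) :=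
  match split i with inl j => u1 j | inr j => u2 j end.
exists (n1 + n2)%N, (glue c1 c2), (glue g1 g2); split.
  by move=> i; rewrite /glue; case: (split i).
rewrite big_split_ord /=; congr (_ + _); apply: eq_bigr => i _.
  by rewrite /glue (unsplitK (inl i)).
by rewrite /glue (unsplitK (inr i)).
Qed.

Lemma ideal_genN S f : ideal_gen S f -> ideal_gen S (- f).
Proof. by rewrite -mulN1r; apply: ideal_genM. Qed.

Lemma ideal_gen_sum S n (F : 'I_n -> {mpoly K[m]}) :
  (forall i, ideal_gen S (F i)) -> ideal_gen S (\sum_(i < n) F i).
Proof.
move=> SF; elim/big_ind: _ => [|f g|i _].
- exact: ideal_gen0.
- exact: ideal_genD.
- exact: SF.
Qed.

Lemma ideal_gen_trans S T f :
  (forall g, S g -> ideal_gen T g) -> ideal_gen S f -> ideal_gen T f.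
Proof.
move=> ST [n [c [g [Sg ->]]]]; apply: ideal_gen_sum => i.
by apply/ideal_genM/ST.
Qed.

Lemma gen_seq_mem (G : seq {mpoly K[m]}) g : g \in G -> gen_seq G g.
Proof. exact: ideal_gen_mem. Qed.

Lemma gen_seq_sub (G H : seq {mpoly K[m]}) f :
  {subset G <= H} -> gen_seq G f -> gen_seq H f.
Proof. by move=> GH; apply: ideal_gen_trans => g /GH /gen_seq_mem. Qed.

End IdealGeneration.

(** * Monomials of binomials, their supports and evaluation at 0/1 points *)

Section Binomials.
Local Set Implicit Arguments.
Local Unset Strict Implicit.
Context {m : nat} {K : fieldType}.
Implicit Types (a b c : 'X_{1..m}) (f g : {mpoly K[m]}).

Lemma msupp_binom a b : a != b ->
  perm_eq (msupp ('X_[a] - 'X_[b] : {mpoly K[m]})) [:: a; b].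
Proof.
move=> ab; apply: uniq_perm; first exact: msupp_uniq.
  by rewrite /= inE ab.
move=> n; rewrite mcoeff_msupp mcoeffB !mcoeffX !inE ![n == _]eq_sym.
case: (a =P n) => [<-|_]; first by rewrite [b == a]eq_sym (negPf ab) subr0 oner_eq0.
by case: (b == n); rewrite ?subrr ?eqxx // sub0r oppr_eq0 oner_eq0.
Qed.

Lemma size_msupp_binomial g : is_binomial g -> (size (msupp g) <= 2)%N.
Proof.
move=> [a [b ->]]; case: (eqVneq a b) => [->|ab]; first by rewrite subrr msupp0.
by rewrite (perm_size (msupp_binom ab)).
Qed.

Lemma sqfree_binomial_is_binomial g : is_sqfree_binomial g -> is_binomial g.
Proof. by move=> [a [b [_ _ ->]]]; exists a, b. Qed.

Lemma size_msupp_sqfree_binomial g :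
  is_sqfree_binomial g -> g != 0 -> size (msupp g) = 2.
Proof.
move=> [a [b [_ _ ->]]] nz; have ab : a != b.
  by apply: contraNneq nz => ->; rewrite subrr.
by rewrite (perm_size (msupp_binom ab)).
Qed.

Lemma sqfree_binomialN g : is_sqfree_binomial (- g) -> is_sqfree_binomial g.
Proof.
move=> [a [b [sa sb /eqP]]]; rewrite eqr_oppLR opprB => /eqP->.
by exists b, a.
Qed.

(** Either monomial can be put first at the cost of a sign, so later arguments need not distinguish
    the two terms of a binomial. *)
Lemma binomial_msuppP g a : is_binomial g -> a \in msupp g ->
  exists b s, [/\ a != b, b \in msupp g & g = (-1) ^+ s * ('X_[a] - 'X_[b])].
Proof.
move=> [p [q ->]]; case: (eqVneq p q) => [->|pq]; first by rewrite subrr msupp0.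
rewrite (perm_mem (msupp_binom pq)) !inE => /orP[]/eqP->.
  exists q, 0%N; rewrite expr0 mul1r (perm_mem (msupp_binom pq)) !inE eqxx orbT.
  by split.
exists p, 1%N; rewrite eq_sym pq expr1 mulN1r opprB.
by rewrite (perm_mem (msupp_binom pq)) !inE eqxx.
Qed.

Lemma sqfree_binomial_msupp g a :
  is_sqfree_binomial g -> a \in msupp g -> squarefree_mon a.
Proof.
move=> [p [q [sp sq ->]]]; case: (eqVneq p q) => [->|pq]; first by rewrite subrr msupp0.
by rewrite (perm_mem (msupp_binom pq)) !inE => /orP[]/eqP->.
Qed.

(** Expanding a combination of generators creates only multiples of monomials of generators, and
    cancellation only removes terms. *)
Lemma msupp_gen_seq (G : seq {mpoly K[m]}) f c : gen_seq G f -> c \in msupp f ->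
  exists g a, [/\ g \in G, a \in msupp g & (a <= c)%MM].
Proof.
move=> [n [d [h [Gh ->]]]] /msupp_sum_le /flattenP[_ /mapP[i _ ->]].
move=> /msuppM_le /allpairsP[[p a] /= [_ ain ->]].
by exists (h i), a; split=> //; rewrite lem_addl.
Qed.

Definition mnm_supp a : {set 'I_m} := [set i | a i != 0%N].

Lemma mnm_supp_le a b : (a <= b)%MM -> mnm_supp a \subset mnm_supp b.
Proof.
move=> /mnm_lepP ab; apply/subsetP => i; rewrite !inE -!lt0n => a0.
exact: leq_trans (ab i).
Qed.

Lemma sqfree_mnm_supp_le a b :
  squarefree_mon a -> mnm_supp a \subset mnm_supp b -> (a <= b)%MM.
Proof.
move=> sa /subsetP ab; apply/mnm_lepP => i; have := ab i; rewrite !inE.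
case: (a i) (sa i) => [|[|//]] // _ /(_ isT); by rewrite lt0n.
Qed.

Definition supp_point a (i : 'I_m) : K := (a i != 0%N)%:R.

(** The product of 0/1 coordinates vanishes as soon as one variable of ['X_[b]] sits at a zero of
    the point; absent variables contribute 1. *)
Lemma meval_supp_point a b :
  meval (supp_point a) 'X_[b] = (mnm_supp b \subset mnm_supp a)%:R.
Proof.
rewrite mevalX; case: (boolP (_ \subset _)) => [/subsetP ba | /subsetPn[i]].
  apply: big1 => i _; have := ba i; rewrite !inE /supp_point.
  by case: eqP => [->|_ /(_ isT) ->]; rewrite ?expr0 ?expr1n.
rewrite !inE negbK => bi /eqP ai; rewrite (bigD1 i) //= /supp_point ai.
by rewrite expr0n (negPf bi) mul0r.
Qed.

End Binomials.

(** * Consequences of minimality and of uniqueness *)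

Section UniqueMinimalGenerators.
Local Set Implicit Arguments.
Local Unset Strict Implicit.
Context {m : nat} {K : fieldType} {I : {mpoly K[m]} -> Prop}.
Context {G : seq {mpoly K[m]}}.
Implicit Types (f g h : {mpoly K[m]}).
Hypothesis minG : minimal_binomial_gens I G.

Lemma minimal_gens_irredundant g : g \in G -> ~ gen_seq (rem g G) g.
Proof.
case: minG => uG _ IG min gG gg; apply: (min (rem g G)).
- exact: mem_rem.
- by move=> /(_ g gG); rewrite mem_rem_uniq // inE eqxx.
- move=> f; split=> [|/IG]; first by move=> /(gen_seq_sub (@mem_rem _ g G)) /IG.
  apply: ideal_gen_trans => h hG; case: (eqVneq h g) => [->//|hg].
  by apply: gen_seq_mem; rewrite mem_rem_uniq // inE hg.
Qed.

Lemma minimal_gens_neq0 g : g \in G -> g != 0.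
Proof.
move=> gG; apply/eqP => g0; apply: (minimal_gens_irredundant gG).
by rewrite {2}g0; apply: ideal_gen0.
Qed.

Lemma minimal_gens_binomial g : g \in G -> is_binomial g.
Proof. by case: minG => _ + _ _ gG; apply. Qed.

Hypothesis uniqI : unique_minimal_binomial_gens I.

(* Passing to a smaller generating subsystem until the system is minimal. *)
Lemma unique_minimal_gens_mem (H : seq {mpoly K[m]}) g :
  (forall h, h \in H -> is_binomial h) -> same_ideal (gen_seq H) I ->
  g \in G -> (g \in H) || (- g \in H).
Proof.
have [n] := ubnP (size H); elim: n H => // n IHn H /ltnSE szH binH genH gG.
apply/negPn/negP => gH.
(* Uniqueness applied to [G] and [undup H] would contradict [gH]. Minimality holds because, by
   induction, a proper generating subsystem would already contain [g] up to sign. *)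
suff minH : minimal_binomial_gens I (undup H).
  by move/negP: gH; apply; have := uniqI minG minH gG; rewrite !mem_undup.
split; first exact: undup_uniq.
- by move=> h; rewrite mem_undup; apply: binH.
- move=> f; rewrite -genH.
  by split; apply: gen_seq_sub => h; rewrite mem_undup.
move=> H' subH' nsub genH'; move/negP: gH; apply.
have {}subH' : {subset H' <= H} by move=> h /subH'; rewrite mem_undup.
have lt_sz : (size (undup H') < size H)%N.
  rewrite ltnNge; apply/negP => le_sz; apply: nsub => h.
  have [_ e] := uniq_min_size (undup_uniq H') (s2 := H)
     (fun x xH' => subH' x (etrans (esym (mem_undup H' x)) xH')) le_sz.
  by rewrite mem_undup -e mem_undup.
have := IHn (undup H') (leq_trans lt_sz szH); rewrite !mem_undup.
have bin' h : h \in undup H' -> is_binomial h.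
  by rewrite mem_undup => /subH' /binH.
have gen' : same_ideal (gen_seq (undup H')) I.
  by move=> f; rewrite -genH'; split; apply: gen_seq_sub => h; rewrite mem_undup.
by case/(_ bin' gen' gG)/orP => /subH' ->; rewrite ?orbT.
Qed.

(* Otherwise [g = +-(x^a - x^b)] could be exchanged for
   [x^(a - a' + b') - x^b], where [g' = +-(x^a' - x^b')]. *)
Lemma unique_minimal_gens_antichain g g' (a a' : 'X_{1..m}) :
  g \in G -> g' \in G -> a \in msupp g -> a' \in msupp g' -> (a' <= a)%MM ->
  g = g'.
Proof.
move=> gG g'G ag ag' le_a'a; apply/eqP/negPn/negP => neq_gg'.
have [b [s [ab _ gE]]] := binomial_msuppP (minimal_gens_binomial gG) ag.
have [b' [s' [ab' _ g'E]]] :=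
  binomial_msuppP (minimal_gens_binomial g'G) ag'.
have [uG binG genG _] := minG.
pose e := (a - a' + b')%MM.
pose h : {mpoly K[m]} := 'X_[e] - 'X_[b].
(* Since [a'] divides [a], multiplying [g'] by ['X_[a - a']] gives, up to sign, ['X_[a] - 'X_[e]];
   the subtraction cancels ['X_[a]]. *)
have hE : h = (-1) ^+ s * g - (-1) ^+ s' * 'X_[a - a'] * g'.
  rewrite gE g'E [_ ^+ s' * _]mulrC -!mulrA !signrMK.
  by rewrite mulrBr -!mpolyXD submK // opprB [RHS]addrC subrKA.
have neq_ea : e != a.
  apply: contraNneq ab' => e_a.
  by rewrite -(eqm_add2l (a - a')) submK // -/e e_a.
pose G1 := h :: rem g G.
have g'r : g' \in rem g G by rewrite mem_rem_uniq // inE eq_sym neq_gg'.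
have binG1 f : f \in G1 -> is_binomial f.
  by rewrite inE => /orP[/eqP->|/mem_rem/binG//]; exists e, b.
have genG1 : same_ideal (gen_seq G1) I.
  move=> f; rewrite -genG; split; apply: ideal_gen_trans => k; last first.
    case: (eqVneq k g) => [-> _|kg kG]; last first.
      by apply: gen_seq_mem; rewrite inE mem_rem_uniq // inE kg kG orbT.
    have -> : g = (-1) ^+ s * h + (-1) ^+ s * ((-1) ^+ s' * 'X_[a - a'] * g').
      by rewrite -mulrDr hE addrNK signrMK.
    apply: ideal_genD; do ?apply: ideal_genM; apply: gen_seq_mem.
      exact: mem_head.
    by rewrite inE g'r orbT.
  rewrite inE => /orP[/eqP->|/mem_rem/gen_seq_mem//]; rewrite hE.
  by apply: ideal_genD; [|apply: ideal_genN]; apply: ideal_genM; apply: gen_seq_mem.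
(* The monomial [a] has coefficient 1 or -1 in [g] up to sign, but 0 in [h], as [a] differs from
   both [e] and [b]. *)
have neq_h t : (-1) ^+ t * g <> h.
  move=> /(congr1 (fun f => f@_a)).
  rewrite gE mulrA -exprD -signr_odd mulr_sign /h.
  have coef_h : ('X_[e] - 'X_[b] : {mpoly K[m]})@_a = 0.
    by rewrite mcoeffB !mcoeffX (negPf neq_ea) [b == a]eq_sym (negPf ab) subr0.
  have coef_g : ('X_[a] - 'X_[b] : {mpoly K[m]})@_a = 1.
    by rewrite mcoeffB !mcoeffX eqxx [b == a]eq_sym (negPf ab) subr0.
  rewrite coef_h; case: (odd _); rewrite ?mcoeffN coef_g => /eqP.
    by rewrite oppr_eq0 oner_eq0.
  by rewrite oner_eq0.
have := unique_minimal_gens_mem binG1 genG1 gG; rewrite !inE.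
case/orP => /orP[/eqP|].
- by move=> gh; case: (neq_h 0%N); rewrite mul1r.
- by rewrite mem_rem_uniq // inE eqxx.
- by move=> gh; case: (neq_h 1%N); rewrite expr1 mulN1r.
move=> Ng; apply: (minimal_gens_irredundant gG).
by rewrite -[X in gen_seq _ X]opprK; apply/ideal_genN/gen_seq_mem.
Qed.

End UniqueMinimalGenerators.

(** * Binomials of the lattice ideal and membership in the lattice *)

Section LatticeIdeal.
Local Set Implicit Arguments.
Local Unset Strict Implicit.
Context {m : nat} {K : fieldType}.
Implicit Types (a b n : 'X_{1..m}) (f p q : {mpoly K[m]}).

(** This is the linear functional that sends each monomial ['X_[n]] to [w n]. *)
Definition weighted_coef_sum (w : 'X_{1..m} -> K) p : K :=
  \sum_(n <- msupp p) p@_n * w n.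

(** A common index set, large enough for several polynomials at once, makes linearity a termwise
    check. *)
Lemma weighted_coef_sumE w p k : (msize p <= k)%N ->
  weighted_coef_sum w p = \sum_(n : 'X_{1..m < k}) p@_n * w n.
Proof.
move=> le_pk; pose J : subFinType _ := 'X_{1..m < k}.
rewrite /weighted_coef_sum (ssrcomplements.big_mksub J) ?msupp_uniq //=; last first.
  by move=> x /msize_mdeg_lt /leq_trans; apply.
by rewrite big_rmcond //= => j /memN_msupp_eq0 ->; rewrite mul0r.
Qed.

Lemma weighted_coef_sumD w :
  {morph weighted_coef_sum w : p q / p + q}.
Proof.
move=> p q; pose k := maxn (msize (p + q)) (maxn (msize p) (msize q)).
rewrite !(@weighted_coef_sumE _ _ k) /k ?leq_max ?leqnn ?orbT //.
by rewrite -big_split /=; apply: eq_bigr => n _; rewrite mcoeffD mulrDl.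
Qed.

Lemma weighted_coef_sum0 w : weighted_coef_sum w 0 = 0.
Proof. by rewrite /weighted_coef_sum msupp0 big_nil. Qed.

Lemma weighted_coef_sumZ w c p :
  weighted_coef_sum w (c *: p) = c * weighted_coef_sum w p.
Proof.
pose k := maxn (msize (c *: p)) (msize p).
rewrite !(@weighted_coef_sumE _ _ k) /k ?leq_max ?leqnn ?orbT // mulr_sumr.
by apply: eq_bigr => n _; rewrite mcoeffZ mulrA.
Qed.

Lemma weighted_coef_sum_binom w a b :
  weighted_coef_sum w ('X_[a] - 'X_[b]) = w a - w b.
Proof.
rewrite weighted_coef_sumD -scaleN1r weighted_coef_sumZ mulN1r.
by rewrite /weighted_coef_sum !msuppX !big_seq1 !mcoeffX !eqxx !mul1r.
Qed.

Definition mnm_row a : 'rV[int]_m := \row_i (a i)%:Z.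

Lemma mnm_rowD a b : mnm_row (a + b)%MM = mnm_row a + mnm_row b.
Proof. by apply/rowP => i; rewrite !mxE mnmDE PoszD. Qed.

Lemma mnm_row_posp_negp u : mnm_row (posp u) - mnm_row (negp u) = u.
Proof.
apply/rowP => i; rewrite !mxE !mnmE; case: (lerP 0 (u ord0 i)) => u0.
  by rewrite max_r ?oppr_le0 // gez0_abs // subr0.
have Nu0 : 0 <= - u ord0 i by rewrite oppr_ge0 ltW.
by rewrite (max_l Nu0) (gez0_abs Nu0) sub0r opprK.
Qed.

Variable L : {pred 'rV[int]_m}.
Hypothesis latL : is_lattice L.

(* The functional summing the coefficients over one congruence class modulo [L]
   vanishes on [I_L]. *)
Lemma lattice_ideal_binom a b :
  @lattice_ideal m K L ('X_[a] - 'X_[b]) -> mnm_row a - mnm_row b \in L.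
Proof.
have [L0 LB] := latL.
have LN u : u \in L -> - u \in L by move=> uL; rewrite -sub0r; apply: LB.
have LD u v : u \in L -> v \in L -> u + v \in L.
  by move=> uL vL; rewrite -[v]opprK; apply/LB/LN.
(* The indicator of the class of [b] modulo [L]: on ['X_[a] - 'X_[b]] the functional gives
   [w a - 1], which is zero only if [a] lies in that class. *)
pose w n : K := (mnm_row n - mnm_row b \in L)%:R.
suff w0 f : @lattice_ideal m K L f -> weighted_coef_sum w f = 0.
  move=> /w0; rewrite weighted_coef_sum_binom /w subrr L0.
  by case: (_ \in L) => // /eqP; rewrite sub0r oppr_eq0 oner_eq0.
move=> [n [c [g [Lg ->]]]].
elim/big_ind: _ => [|p q p0 q0|i _]; first exact: weighted_coef_sum0.
  by rewrite weighted_coef_sumD p0 q0 addr0.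
(* By linearity the coefficient may be taken to be a monomial; the two exponents of its product with
   [lbinom u] then differ by [u], so they are congruent modulo [L]. *)
have [u uL ->] := Lg i; rewrite [c i]mpolyE mulr_suml.
elim/big_ind: _ => [|p q p0 q0|k _]; first exact: weighted_coef_sum0.
  by rewrite weighted_coef_sumD p0 q0 addr0.
rewrite -scalerAl weighted_coef_sumZ /lbinom mulrBr -!mpolyXD.
rewrite weighted_coef_sum_binom /w !mnm_rowD.
have -> : mnm_row (posp u) = u + mnm_row (negp u).
  by rewrite -{2}[u]mnm_row_posp_negp addrNK.
set v := _ + mnm_row (negp u) - _.
have -> : mnm_row k + (u + mnm_row (negp u)) - mnm_row b = u + v.
  by rewrite /v addrCA -!addrA.
suff -> : (u + v \in L) = (v \in L) by rewrite subrr mulr0.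
apply/idP/idP => [uvL|]; last exact: LD.
by rewrite -[v](addKr u); apply: LD => //; apply: LN.
Qed.

Hypothesis posL : forall u, u \in L -> (forall i, 0 <= u ord0 i) -> u = 0.

Lemma lattice_ideal_binom_le a b :
  @lattice_ideal m K L ('X_[a] - 'X_[b]) -> (b <= a)%MM -> a = b.
Proof.
move=> /lattice_ideal_binom abL /mnm_lepP le_ba.
have /rowP ab0 : mnm_row a - mnm_row b = 0.
  by apply: posL => // i; rewrite !mxE subr_ge0 lez_nat.
apply/mnmP => i; have /eqP := ab0 i.
by rewrite !mxE subr_eq0 eqz_nat => /eqP.
Qed.

End LatticeIdeal.

(** * The upper bound by [G] itself and the lower bound by counting supports *)

Theorem theorem2p16 (m : nat) (K : fieldType) (L : {pred 'rV[int]_m}) :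
  is_lattice L ->
  (exists2 u, u \in L & u != 0) ->
  (forall u, u \in L -> (forall i, 0 <= u ord0 i) -> u = 0) ->
  (exists G : seq {mpoly K[m]},
      (forall g, g \in G -> is_sqfree_binomial g) /\
      same_ideal (gen_seq G) (@lattice_ideal m K L)) ->
  unique_minimal_binomial_gens (@lattice_ideal m K L) ->
  forall G : seq {mpoly K[m]},
    minimal_binomial_gens (@lattice_ideal m K L) G ->
    bar_is (@lattice_ideal m K L) (size G).
Proof.
move=> latL _ posL [G0 [sqG0 genG0]] uniqI G minG.
have [uG binG genG _] := minG.
split.
  exists G => //; split=> [g gG|f].
    by split; [exact: binG | apply/genG/gen_seq_mem].
  by split=> -[k /genG fk]; exists k.
move=> B [binB radB].
have sqG g : g \in G -> is_sqfree_binomial g.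
  move=> gG.
  have := unique_minimal_gens_mem minG uniqI _ genG0 gG.
  case/(_ (fun h hG => sqfree_binomial_is_binomial (sqG0 h hG)))/orP.
    exact: sqG0.
  by move/sqG0/sqfree_binomialN.
(* Two distinct generators are excluded by uniqueness; the two monomials of a single generator are
   incomparable because [L] has no non-zero vector with non-negative entries. *)
have antichain g g' a a' : g \in G -> g' \in G -> a \in msupp g ->
    a' \in msupp g' -> (a' <= a)%MM -> g = g' /\ a = a'.
  move=> gG g'G ag a'g' le_a'a.
  have gg' := unique_minimal_gens_antichain minG uniqI gG g'G ag a'g' le_a'a.
  split=> //; rewrite -{}gg' in a'g'.
  have [b [s [ab bg gE]]] := binomial_msuppP (binG g gG) ag.
  have Iab : @lattice_ideal m K L ('X_[a] - 'X_[b]).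
    have -> : 'X_[a] - 'X_[b] = (-1) ^+ s * g by rewrite gE signrMK.
    by apply/genG/ideal_genM/gen_seq_mem.
  have {}a'g' : a' \in msupp ('X_[a] - 'X_[b] : {mpoly K[m]}).
    move: a'g'; rewrite gE -signr_odd mulr_sign.
    by case: (odd s) => //; rewrite (perm_mem (msuppN _)).
  move: a'g'; rewrite (perm_mem (msupp_binom ab)).
  rewrite !inE => /orP[/eqP->//|/eqP a'b]; rewrite a'b in le_a'a *.
  exact: (lattice_ideal_binom_le latL posL Iab).
pose supps (F : seq {mpoly K[m]}) := [seq mnm_supp a | g <- F, a <- msupp g].
have uniq_supps : uniq (supps G).
  apply: allpairs_uniq_dep => //.
  move=> _ _ /allpairsPdep[g [a [gG ag ->]]] /allpairsPdep[g' [a' [g'G a'g' ->]]].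
  move=> /= eq_supp.
  have le_a'a : (a' <= a)%MM.
    apply: (sqfree_mnm_supp_le (sqfree_binomial_msupp (sqG _ g'G) a'g')).
    by rewrite eq_supp.
  by have [-> ->] := antichain _ _ _ _ gG g'G ag a'g' le_a'a.
have sub_supps : {subset supps G <= supps B}.
  move=> _ /allpairsPdep[g [a [gG ag ->]]].
  have [b [s [ab bg gE]]] := binomial_msuppP (binG g gG) ag.
  (* The monomial [b] vanishes at this point: otherwise, being squarefree, it would divide [a],
     against the antichain property. *)
  have gv : meval (supp_point a) g = (-1) ^+ s.
    rewrite gE mevalM mevalB !meval_supp_point subxx rmorphXn rmorphN1 /=.
    case: (boolP (_ \subset _)) => [ba|]; last by rewrite subr0 mulr1.
    have le_ba := sqfree_mnm_supp_le (sqfree_binomial_msupp (sqG _ gG) bg) ba.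
    have [_ e] := antichain _ _ _ _ gG gG ag bg le_ba.
    by rewrite e eqxx in ab.
  have [k [n [c [h [hB gk]]]]] : radical (gen_seq B) g.
    by apply/radB; exists 1%N; apply/genG/gen_seq_mem.
  (* If every [h i] vanished there, so would [g ^+ k], whose value is a power of a sign. *)
  have [i hv] : exists i, meval (supp_point a) (h i) != 0.
    apply/existsP; apply: contraT => /existsPn hv.
    have := congr1 (meval (supp_point a)) gk.
    rewrite rmorphXn /= gv rmorph_sum big1 => [/eqP|i _].
      by rewrite expf_eq0 signr_eq0 andbF.
    by move/eqP: (negbNE (hv i)); rewrite rmorphM /= => ->; rewrite mulr0.
  have [binh Ih] := binB _ (hB i).
  have [d dh d_sub] : exists2 d, d \in msupp (h i) & mnm_supp d \subset mnm_supp a.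
    apply/hasP; apply: contraT => /hasPn nsub; case/eqP: hv.
    rewrite [h i]mpolyE rmorph_sum /= big_seq big1 // => d dh.
    by rewrite mevalZ meval_supp_point (negPf (nsub d dh)) mulr0.
  have [g' [a' [g'G a'g' le_a'd]]] := msupp_gen_seq ((genG _).2 Ih) dh.
  have le_a'a : (a' <= a)%MM.
    apply: (sqfree_mnm_supp_le (sqfree_binomial_msupp (sqG _ g'G) a'g')).
    exact: subset_trans (mnm_supp_le le_a'd) d_sub.
  have [_ aa'] := antichain _ _ _ _ gG g'G ag a'g' le_a'a.
  apply/allpairsPdep; exists (h i), d; split=> //.
  by apply/eqP; rewrite eqEsubset d_sub {1}aa' mnm_supp_le.
have size_G : size (supps G) = (size G * 2)%N.
  rewrite size_allpairs_dep sumnE big_map big_seq.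
  rewrite (eq_bigr (fun=> 2)) => [|g gG]; last first.
    by apply: size_msupp_sqfree_binomial (sqG _ gG) (minimal_gens_neq0 minG gG).
  by rewrite -big_seq big_const_seq count_predT iter_addn_0 mulnC.
(* Only an inequality, since [B] may contain zero binomials; the elements of [G] are non-zero and
   have exactly two monomials each. *)
have size_B : (size (supps B) <= size B * 2)%N.
  rewrite size_allpairs_dep sumnE big_map big_seq.
  apply: (@leq_trans (\sum_(g <- B | g \in B) 2)).
    by apply: leq_sum => g /binB[bg _]; apply: size_msupp_binomial.
  by rewrite -big_seq big_const_seq count_predT iter_addn_0 mulnC.
rewrite -(leq_pmul2r (ltn0Sn 1)) -size_G.
exact: leq_trans (uniq_leq_size uniq_supps sub_supps) size_B.
Qed.
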